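(* Assume that the representation $W_{\mathbf{L},\mathbf{K}}$ is generic. Then the following conditions are equivalent: (1) $\mathbf{0}\not\in\Psi_{\mathbf{L},\mathbf{K}}\big(\mathbb{P}(W_{\mathbf{L},\mathbf{K}})\big)$; (2) $\mathbf{0}\not\in\Phi_{\mathbf{L},\mathbf{K}}\big(\mathbb{P}(W_{\mathbf{L},\mathbf{K}})\big)$; (3) either $k_a+2\,l_a>0$ for all $a=1,\ldots,r$, or $k_a+2\,l_a<0$ for all $a=1,\ldots,r$.
   Context: $G=U(2)$, $\mathfrak{g}=\mathfrak{u}(2)$ is the space of $2\times 2$ skew-Hermitian matrices, $T\le G$ the torus of diagonal matrices, and $\mathfrak{t}\subset\mathfrak{g}$ the diagonal skew-Hermitian matrices. For $k\ge 0$ write points of $\mathbb{C}^{k+1}$ as $Z=(z_0,\ldots,z_k)^t$ and set $F_{k,1}(Z):=\left(\sqrt{k-j+1}\,z_{j-1}\right)_{j=1}^k$, $F_{k,2}(Z):=\left(\sqrt{j}\,z_j\right)_{j=1}^k$ in $\mathbb{C}^k$ (these are $0$ if $k=0$). Let $r\ge 1$, $\mathbf{L}=(l_a)\in\mathbb{Z}^r$, $\mathbf{K}=(k_a)\in\mathbb{N}^r$, and $W_{\mathbf{L},\mathbf{K}}=\bigoplus_{a=1}^r\det^{\otimes l_a}\otimes\mathrm{Sym}^{k_a}(\mathbb{C}^2)\cong\bigoplus_{a=1}^r\mathbb{C}^{k_a+1}$ (composed with the automorphism $B\mapsto(B^t)^{-1}$ of $G$). Write $Z=(Z_a)_{a=1}^r$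 with $Z_a\in\mathbb{C}^{k_a+1}$. The moment map (with respect to twice the Fubini-Study form) of the $G$-action on $\mathbb{P}(W_{\mathbf{L},\mathbf{K}})$ is $\Phi_{\mathbf{L},\mathbf{K}}:\mathbb{P}(W_{\mathbf{L},\mathbf{K}})\to\mathfrak{g}$, $$\Phi_{\mathbf{L},\mathbf{K}}([Z])=\frac{\imath}{\|Z\|^2}\sum_{a=1}^r\begin{pmatrix}\|F_{k_a,1}(Z_a)\|^2+l_a\|Z_a\|^2& F_{k_a,2}(Z_a)^t\,\overline{F_{k_a,1}(Z_a)}\\ F_{k_a,1}(Z_a)^t\,\overline{F_{k_a,2}(Z_a)}&\|F_{k_a,2}(Z_a)\|^2+l_a\|Z_a\|^2\end{pmatrix},$$ and the moment map $\Psi_{\mathbf{L},\mathbf{K}}:\mathbb{P}(W_{\mathbf{L},\mathbf{K}})\to\mathfrak{t}$ of the $T$-action is the diagonal part of $\Phi_{\mathbf{L},\mathbf{K}}$. The representation $W_{\mathbf{L},\mathbf{K}}$ is called generic if, whenever for some $l\in\mathbb{Z}$ the pair $(l,1)$ appears in the sequence $(l_1,k_1),\ldots,(l_r,k_r)$, there are $1\le a<b\le r$ with $(l_a,k_a)=(l_b,k_b)=(l,1)$. *)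

(* Defs.v *)
From HB Require Import structures.
From mathcomp Require Import all_boot all_order all_algebra.
From mathcomp Require Import classical_sets reals.
From mathcomp.real_closed Require Import complex.

Set Implicit Arguments.
Unset Strict Implicit.
Unset Printing Implicit Defensive.

Import Order.TTheory GRing.Theory Num.Theory.
Local Open Scope ring_scope.

Section Projective.
Context {F : fieldType} {V : vectType F}.

(* Points of P(V) are the lines (one-dimensional subspaces) of V. *)
Definition proj_space : Type := {U : {vspace V} | \dim U == 1%N}.

Fact proj_pt_subproof (v : V) : v != 0 -> \dim <[v]> == 1%N.
Proof. by move=> v0; rewrite dim_vline v0. Qed.

Definition proj_pt (v : V) (v0 : v != 0) : proj_space :=
  exist _ <[v]>%VS (proj_pt_subproof v0).

Definition proj_repr (x : proj_space) : V := vpick (val x).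

Lemma proj_repr_neq0 (x : proj_space) : proj_repr x != 0.
Proof.
case: x => U dU; rewrite /proj_repr /= vpick0.
by apply: contraTneq dU => ->; rewrite dimv0.
Qed.

Lemma proj_reprK (x : proj_space) : proj_pt (proj_repr_neq0 x) = x.
Proof.
apply/val_inj/eqP; rewrite eqEdim /= -memvE memv_pick dim_vline proj_repr_neq0.
by rewrite (eqP (valP x)).
Qed.

Lemma proj_repr_pt (v : V) (v0 : v != 0) :
  exists2 c : F, c != 0 & proj_repr (proj_pt v0) = c *: v.
Proof.
have /vlineP[c ec] : proj_repr (proj_pt v0) \in <[v]>%VS by exact: memv_pick.
exists c => //; have := proj_repr_neq0 (proj_pt v0).
by rewrite ec; apply: contraNneq => ->; rewrite scale0r.
Qed.

End Projective.

Arguments proj_space {F} V.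

Section MomentMaps.
Context {R : realType}.
Local Notation C := R[i].

Definition mx22 (a b c d : C) : 'M[C]_2 :=
  \matrix_(i, j) if i == 0 then (if j == 0 then a else b)
                           else (if j == 0 then c else d).

Definition normsq n (Z : 'cV[C]_n) : C := \sum_(i < n) `|Z i 0| ^+ 2.

(* u^t conj(v) *)
Definition dotC n (u v : 'cV[C]_n) : C := (u^T *m map_mx Num.conj v) 0 0.

(* The coordinates of the columns F1 Z and F2 Z are indexed by j = 0, .., k-1
   instead of 1, .., k. *)
Definition F1 k (Z : 'cV[C]_k.+1) : 'cV[C]_k :=
  \col_(j < k) (sqrtC (k - j)%:R * Z (widen_ord (leqnSn k) j) 0).

Definition F2 k (Z : 'cV[C]_k.+1) : 'cV[C]_k :=
  \col_(j < k) (sqrtC j.+1%:R * Z (lift ord0 j) 0).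

(* The Lie algebra u(2) and its diagonal subalgebra t. *)
Definition skew_hermitian (A : 'M[C]_2) : bool := (map_mx Num.conj A)^T == - A.

Definition diag_skew_hermitian (A : 'M[C]_2) : bool :=
  is_diag_mx A && skew_hermitian A.

Section Representation.
Variables (r : nat) (L : 'I_r -> int) (K : 'I_r -> nat).

(* The space underlying the representation W_{L,K}, i.e., the direct sum of
   the C^(k_a + 1); the component Z_a of Z is submxcol Z a. *)
Definition W : vectType C := 'cV[C]_(\sum_(a < r) (K a).+1).

Definition Phi_vec (Z : W) : 'M[C]_2 :=
  ('i / normsq Z) *: \sum_(a < r)
    let Za : 'cV[C]_(K a).+1 := submxcol Z a in
    mx22 (normsq (F1 Za) + (L a)%:~R * normsq Za) (dotC (F2 Za) (F1 Za))
         (dotC (F1 Za) (F2 Za)) (normsq (F2 Za) + (L a)%:~R * normsq Za).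

(* Phi_vec is constant on lines (Phi_vecZ), so the choice of a representative
   does not matter: see Phi_pt. *)
Definition Phi (x : proj_space W) : 'M[C]_2 := Phi_vec (proj_repr x).

Definition Psi (x : proj_space W) : 'M[C]_2 := diag_mx (\row_i Phi x i i).

Definition generic : Prop :=
  forall l : int, (exists a : 'I_r, (L a, K a) = (l, 1%N)) ->
  exists a b : 'I_r,
    [/\ (a < b)%N, (L a, K a) = (l, 1%N) & (L b, K b) = (l, 1%N)].

Lemma normsqZ n c (Z : 'cV[C]_n) : normsq (c *: Z) = `|c| ^+ 2 * normsq Z.
Proof.
by rewrite /normsq mulr_sumr; apply: eq_bigr => i _; rewrite mxE normrM exprMn.
Qed.

Lemma dotCZ n c (u v : 'cV[C]_n) : dotC (c *: u) (c *: v) = `|c| ^+ 2 * dotC u v.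
Proof.
rewrite /dotC !mxE mulr_sumr; apply: eq_bigr => i _.
by rewrite !mxE rmorphM normCK mulrACA.
Qed.

Lemma F1Z k c (Z : 'cV[C]_k.+1) : F1 (c *: Z) = c *: F1 Z.
Proof. by apply/matrixP => i j; rewrite !mxE mulrCA. Qed.

Lemma F2Z k c (Z : 'cV[C]_k.+1) : F2 (c *: Z) = c *: F2 Z.
Proof. by apply/matrixP => i j; rewrite !mxE mulrCA. Qed.

Lemma Phi_vecZ c (Z : W) : c != 0 -> Phi_vec (c *: Z) = Phi_vec Z.
Proof.
move=> c0; have d0 : `|c| ^+ 2 != 0 by rewrite expf_eq0 normr_eq0.
rewrite /Phi_vec normsqZ invfM mulrCA -scalerA scalerA mulrC.
rewrite -[in LHS]scalerA; congr (_ *: _).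
rewrite scaler_sumr; apply: eq_bigr => a _ /=.
have -> : submxcol (c *: Z) a = c *: submxcol Z a.
  by apply/matrixP => i j; rewrite !mxE.
rewrite F1Z F2Z !normsqZ !dotCZ; apply/matrixP => i j; rewrite !mxE.
by case: ifP => _; case: ifP => _; rewrite ?[_%:~R * (_ * _)]mulrCA -?mulrDr mulKf.
Qed.

Lemma Phi_pt (Z : W) (Z0 : Z != 0) : Phi (proj_pt Z0) = Phi_vec Z.
Proof. by rewrite /Phi; have [c c0 ->] := proj_repr_pt Z0; rewrite Phi_vecZ. Qed.

Lemma normsq_real n (Z : 'cV[C]_n) : (normsq Z)^* = normsq Z.
Proof.
by apply/CrealP/rpred_sum => i _; rewrite rpredX // normr_real.
Qed.

Lemma dotC_conj n (u v : 'cV[C]_n) : (dotC u v)^* = dotC v u.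
Proof.
rewrite /dotC !mxE rmorph_sum; apply: eq_bigr => i _.
by rewrite !mxE rmorphM /= conjCK mulrC.
Qed.

Lemma Phi_skew_hermitian (x : proj_space W) : skew_hermitian (Phi x).
Proof.
apply/eqP/matrixP => i j; rewrite /Phi /Phi_vec !mxE !rmorphM /= fmorphV /=.
rewrite normsq_real conjCi !mulNr; congr (- (_ * _)).
rewrite !summxE rmorph_sum; apply: eq_bigr => a _; rewrite !mxE.
by case: ifP => _; case: ifP => _;
  rewrite /= ?dotC_conj // rmorphD rmorphM /= rmorph_int !normsq_real.
Qed.

Lemma Psi_diag_skew_hermitian (x : proj_space W) : diag_skew_hermitian (Psi x).
Proof.
rewrite /diag_skew_hermitian diag_mx_is_diag /=.
have /eqP/matrixP sk := Phi_skew_hermitian x.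
apply/eqP/matrixP => i j; rewrite !mxE rmorphMn /= eq_sym.
have := sk j j; rewrite !mxE.
have [->|ij] := eqVneq i j; first by rewrite !mulr1n.
by rewrite !mulr0n oppr0.
Qed.

End Representation.
End MomentMaps.

Arguments Phi {R r} L K x.
Arguments Psi {R r} L K x.

(* Main.v *)
(** The trace of [Phi] at [Z] is, up to a nonzero factor, the sum of the
    [(k_a + 2 l_a) ||Z_a||^2], so it cannot vanish when all the [k_a + 2 l_a]
    have the same strict sign.  Conversely every summand can be balanced: the
    numerator of [Phi] is a positive multiple of [(k_a + 2 l_a) I] at the sum of
    the extreme weight vectors [e_0] and [e_k] of the summand if [k_a >= 2], at
    [e_0] if [k_a = 0], and, if [k_a = 1], at the sum of the [e_0] and the [e_1]
    of two isomorphic summands, which genericity provides.  A suitable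
    combination of two balanced vectors with [k_a + 2 l_a <= 0] and
    [k_b + 2 l_b >= 0] is a zero of [Phi]. *)

Require Import Defs.
From mathcomp Require Import all_boot all_order all_algebra.
From mathcomp Require Import classical_sets reals.
From mathcomp.real_closed Require Import complex.
From mathcomp Require Import zify ring.
Import Order.TTheory GRing.Theory Num.Theory.
Local Open Scope ring_scope.
Local Open Scope classical_set_scope.

Set Implicit Arguments.
Unset Strict Implicit.

(** * The unnormalised moment map on a single summand *)

Section Blocks.
Context {R : realType}.
Local Notation C := R[i].

Lemma mx22D (a b c d a' b' c' d' : C) :
  mx22 a b c d + mx22 a' b' c' d' = mx22 (a + a') (b + b') (c + c') (d + d').
Proof. by apply/matrixP => i j; rewrite !mxE; case: ifP => _; case: ifP. Qed.

Lemma mx22Z (x a b c d : C) :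
  x *: mx22 a b c d = mx22 (x * a) (x * b) (x * c) (x * d).
Proof. by apply/matrixP => i j; rewrite !mxE; case: ifP => _; case: ifP. Qed.

Lemma mx22_scalar (a : C) : mx22 a 0 0 a = a%:M.
Proof.
by apply/matrixP => -[[|[|//]] ?] [[|[|//]] ?]; rewrite !mxE.
Qed.

Lemma mxtrace_mx22 (a b c d : C) : \tr (mx22 a b c d) = a + d.
Proof. by rewrite /mxtrace !big_ord_recl big_ord0 !mxE /= addr0. Qed.

Lemma weight_intr (l : int) k : (k%:Z + 2 * l)%:~R = k%:R + 2 * l%:~R :> C.
Proof. by rewrite rmorphD rmorphM. Qed.

Lemma normsq_ge0 n (Z : 'cV[C]_n) : 0 <= normsq Z.
Proof. by apply: sumr_ge0 => i _; rewrite exprn_ge0. Qed.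

Lemma normsq_eq0 n (Z : 'cV[C]_n) : (normsq Z == 0) = (Z == 0).
Proof.
apply/eqP/eqP => [/eqP|->]; last first.
  by apply: big1 => i _; rewrite mxE normr0 expr0n.
rewrite psumr_eq0 => [/allP Z0|i _]; last by rewrite exprn_ge0.
apply/colP => i; rewrite mxE; apply/eqP.
by have := Z0 i (mem_index_enum i); rewrite expf_eq0 normr_eq0.
Qed.

Lemma normr_sqrtC_sqr (n : nat) : `|sqrtC (n%:R : C)| ^+ 2 = n%:R.
Proof. by rewrite -normrX sqrtCK normr_nat. Qed.

(** The coordinate of index [k], absent from [F1 Z], enters with coefficient [k - k], so that the
    sums for [F1] and [F2] share one index set. *)
Lemma normsq_F1 k (Z : 'cV[C]_k.+1) :
  normsq (F1 Z) = \sum_(j < k.+1) (k - j)%:R * `|Z j 0| ^+ 2.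
Proof.
rewrite big_ord_recr /= subnn mul0r addr0; apply: eq_bigr => j _.
by rewrite mxE normrM exprMn normr_sqrtC_sqr.
Qed.

Lemma normsq_F2 k (Z : 'cV[C]_k.+1) :
  normsq (F2 Z) = \sum_(j < k.+1) j%:R * `|Z j 0| ^+ 2.
Proof.
rewrite big_ord_recl /= mul0r add0r; apply: eq_bigr => j _.
by rewrite mxE normrM exprMn normr_sqrtC_sqr.
Qed.

Lemma normsq_F1DF2 k (Z : 'cV[C]_k.+1) :
  normsq (F1 Z) + normsq (F2 Z) = k%:R * normsq Z.
Proof.
rewrite normsq_F1 normsq_F2 -big_split mulr_sumr; apply: eq_bigr => j _ /=.
by rewrite -mulrDl -natrD subnK // -ltnS.
Qed.

(** Each term of the pairing contains one coordinate of [Z] times the conjugate of the next one. *)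
Lemma dotC_F1F2_eq0 k (Z : 'cV[C]_k.+1) :
  (forall j : 'I_k, Z (widen_ord (leqnSn k) j) 0 * Z (lift ord0 j) 0 = 0) ->
  dotC (F1 Z) (F2 Z) = 0.
Proof.
move=> Z0; rewrite /dotC mxE big1 // => j _; rewrite !mxE.
by have /eqP := Z0 j; rewrite mulf_eq0 => /orP[]/eqP->;
  rewrite ?mulr0 ?rmorph0 ?mul0r ?mulr0.
Qed.

Definition block_moment (l : int) k (Z : 'cV[C]_k.+1) : 'M[C]_2 :=
  mx22 (normsq (F1 Z) + l%:~R * normsq Z) (dotC (F2 Z) (F1 Z))
       (dotC (F1 Z) (F2 Z)) (normsq (F2 Z) + l%:~R * normsq Z).

Lemma block_momentZ l k c (Z : 'cV[C]_k.+1) :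
  block_moment l (c *: Z) = `|c| ^+ 2 *: block_moment l Z.
Proof.
by rewrite /block_moment F1Z F2Z !normsqZ !dotCZ mx22Z; congr mx22; ring.
Qed.

Lemma block_moment0 l k : block_moment l (0 : 'cV[C]_k.+1) = 0.
Proof. by rewrite -(scale0r 0) block_momentZ normr0 expr0n scale0r. Qed.

Lemma mxtrace_block_moment l k (Z : 'cV[C]_k.+1) :
  \tr (block_moment l Z) = (k%:Z + 2 * l)%:~R * normsq Z.
Proof.
by rewrite mxtrace_mx22 addrACA normsq_F1DF2 weight_intr; ring.
Qed.

Lemma block_moment_diag l k (Z : 'cV[C]_k.+1) :
  (forall j : 'I_k, Z (widen_ord (leqnSn k) j) 0 * Z (lift ord0 j) 0 = 0) ->
  block_moment l Z = mx22 (normsq (F1 Z) + l%:~R * normsq Z) 0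
                          0 (normsq (F2 Z) + l%:~R * normsq Z).
Proof.
move=> Z0; rewrite /block_moment -[dotC (F2 Z) _]dotC_conj.
by rewrite dotC_F1F2_eq0 // rmorph0.
Qed.

(** With [f] defined on [nat], [in_block] can use the same [f] for blocks of all sizes, without a
    cast. *)
Definition colf (f : nat -> C) k : 'cV[C]_k := \col_(j < k) f j.

Lemma sum_ord_pred1 k (g : nat -> C) m : (m < k)%N ->
  \sum_(j < k) g j * `|(j == m :> nat)%:R : C| ^+ 2 = g m.
Proof.
move=> mk; rewrite (bigD1 (Ordinal mk)) //= eqxx normr1 expr1n mulr1.
rewrite big1 ?addr0 // => j; rewrite -val_eqE /= => /negPf->.
by rewrite normr0 expr0n mulr0.
Qed.

Lemma block_moment_weight l k m : (m <= k)%N ->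
  block_moment l (colf (fun j => (j == m)%:R) k.+1)
  = mx22 ((k - m)%:R + l%:~R) 0 0 (m%:R + l%:~R).
Proof.
move=> mk; rewrite block_moment_diag => [|j]; last first.
  rewrite !mxE /= /bump leq0n add1n -natrM mulnb; apply/eqP.
  by rewrite pnatr_eq0 eqb0; lia.
rewrite normsq_F1 normsq_F2; set Z := colf _ _.
have -> : normsq Z = 1.
  rewrite -[RHS](@sum_ord_pred1 k.+1 (fun=> 1) m) //.
  by apply: eq_bigr => j _; rewrite mxE mul1r.
have sumZ g : \sum_(j < k.+1) g (val j) * `|Z j 0| ^+ 2 = g m.
  rewrite -[RHS](@sum_ord_pred1 k.+1 g m) //.
  by apply: eq_bigr => j _; rewrite mxE.
by rewrite (sumZ (fun j => (k - j)%:R)) (sumZ (fun j => j%:R)) mulr1.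
Qed.

(* For [k = 1] the weight vectors [e_0] and [e_1] are adjacent and contribute an
   off-diagonal term; for [k = 0] they coincide. *)
Lemma block_moment_extremes l k : (1 < k)%N ->
  block_moment l (colf (fun j => ((j == 0%N) || (j == k))%:R) k.+1)
  = ((k%:Z + 2 * l)%:~R)%:M.
Proof.
move=> k1; rewrite block_moment_diag => [|j]; last first.
  rewrite !mxE /= /bump leq0n add1n -natrM mulnb; apply/eqP.
  by rewrite pnatr_eq0 eqb0; lia.
rewrite normsq_F1 normsq_F2; set Z := colf _ _.
have sumZ g : \sum_(j < k.+1) g (val j) * `|Z j 0| ^+ 2 = g 0%N + g k.
  rewrite -(@sum_ord_pred1 k.+1 g 0) // -(@sum_ord_pred1 k.+1 g k) //.
  rewrite -big_split; apply: eq_bigr => j _ /=; rewrite mxE -mulrDr.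
  (* The indices [0] and [k] are distinct, so the two indicators never overlap. *)
  by case: eqP => [->|_]; case: eqP => [kE|_];
    rewrite ?normr0 ?normr1 ?expr0n ?expr1n ?addr0 ?add0r //; lia.
have -> : normsq Z = 2.
  apply: etrans (sumZ (fun=> 1)).
  by apply: eq_bigr => j _; rewrite mul1r.
rewrite (sumZ (fun j => (k - j)%:R)) (sumZ (fun j => j%:R)) subnn subn0 addr0 add0r.
by rewrite mx22_scalar weight_intr [_ * 2]mulrC.
Qed.

End Blocks.

(** * Balanced vectors and zeros in the direct sum *)

Section Moment.
Context {R : realType}.
Local Notation C := R[i].
Variables (r : nat) (L : 'I_r -> int) (K : 'I_r -> nat).
Local Notation W := (@W R r K).

Definition component (Z : W) a : 'cV[C]_(K a).+1 :=
  submxcol (Z : 'cV[C]_(\sum_(a < r) (K a).+1)) a.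

(** The numerator of [Phi_vec]: it has the same zeros on nonzero vectors, and scales by [|c|^2]. *)
Definition moment (Z : W) : 'M[C]_2 :=
  \sum_(a < r) block_moment (L a) (component Z a).

Definition block_weight a : int := (K a)%:Z + 2 * L a.

Lemma Phi_vecE Z : Phi_vec L Z = ('i / normsq Z) *: moment Z.
Proof. by []. Qed.

Lemma componentP (Z1 Z2 : W) :
  (forall a, component Z1 a = component Z2 a) -> Z1 = Z2.
Proof. by move=> Z12; apply/mxcolP. Qed.

Lemma componentD (Z1 Z2 : W) a :
  component (Z1 + Z2) a = component Z1 a + component Z2 a.
Proof. by apply/matrixP => i j; rewrite !mxE. Qed.

Lemma componentZ c (Z : W) a : component (c *: Z) a = c *: component Z a.
Proof. by apply/matrixP => i j; rewrite !mxE. Qed.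

Lemma component0 a : component 0 a = 0.
Proof. by apply/matrixP => i j; rewrite !mxE. Qed.

Definition in_block a (f : nat -> C) : W :=
  \mxcol_(b < r) (if b == a then colf f (K b).+1 else 0).

Lemma component_in_block a f b :
  component (in_block a f) b = if b == a then colf f (K b).+1 else 0.
Proof. exact: mxcolK. Qed.

Lemma in_block_neq0 a f m : (m <= K a)%N -> f m != 0 -> in_block a f != 0.
Proof.
move=> mK; apply: contraNneq => /(congr1 (fun Z => component Z a)).
rewrite component0 component_in_block eqxx => /colP/(_ (Ordinal (mK : m < _.+1)%N)).
by rewrite !mxE /= => ->.
Qed.

Lemma momentZ c Z : moment (c *: Z) = `|c| ^+ 2 *: moment Z.
Proof.
rewrite scaler_sumr; apply: eq_bigr => a _.
by rewrite componentZ block_momentZ.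
Qed.

Lemma moment_in_block a f :
  moment (in_block a f) = block_moment (L a) (colf f (K a).+1).
Proof.
rewrite /moment (bigD1 a) //= big1 => [|b /negPf ba].
  by rewrite component_in_block eqxx addr0.
by rewrite component_in_block ba block_moment0.
Qed.

(** Cross terms can only come from a block where both components are nonzero. *)
Lemma momentD Z1 Z2 :
  (forall a, component Z1 a = 0 \/ component Z2 a = 0) ->
  moment (Z1 + Z2) = moment Z1 + moment Z2.
Proof.
move=> Z12; rewrite -big_split; apply: eq_bigr => a _ /=.
by rewrite componentD; have [->|->] := Z12 a;
  rewrite block_moment0 ?add0r ?addr0.
Qed.

(** The last clause makes balanced vectors of distinct weights satisfy the hypothesis of [momentD].
    It speaks of weights because, for [K a = 1], the vector lives on two summands isomorphic to that
    of [a], which need not include [a]. *)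
Lemma balanced_vector (a : 'I_r) : generic L K ->
  exists (Z : W) (c : C),
    [/\ Z != 0, 0 < c, moment Z = (c * (block_weight a)%:~R)%:M &
        forall b, block_weight b != block_weight a -> component Z b = 0].
Proof.
move=> gen; have [Ka_le1|Ka_gt1] := leqP (K a) 1; last first.
  exists (in_block a (fun j => ((j == 0%N) || (j == K a))%:R)), 1; split => //.
  - by apply: (@in_block_neq0 _ _ 0%N); rewrite // oner_eq0.
  - by rewrite moment_in_block block_moment_extremes // mul1r.
  - move=> b; rewrite component_in_block.
    by have [->|//] := eqVneq b a; rewrite eqxx.
have [Ka0|Ka_neq0] := eqVneq (K a) 0%N.
  (* Here the moment is [L a] times the identity, half of the weight [2 * L a]. *)
  exists (in_block a (fun j => (j == 0%N)%:R)), 2^-1; split.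
  - by apply: (@in_block_neq0 _ _ 0%N); rewrite // oner_eq0.
  - by rewrite invr_gt0 ltr0n.
  - rewrite moment_in_block block_moment_weight // Ka0 !add0r mx22_scalar.
    by rewrite /block_weight weight_intr Ka0 add0r mulKf // pnatr_eq0.
  - move=> b; rewrite component_in_block.
    by have [->|//] := eqVneq b a; rewrite eqxx.
have Ka1 : K a = 1%N by lia.
have [|b [c [bc [Lb Kb] [Lc Kc]]]] := gen (L a); first by exists a; rewrite Ka1.
have neq_bc : b != c by rewrite neq_ltn bc.
pose Zb := in_block b (fun j => (j == 0%N)%:R).
pose Zc := in_block c (fun j => (j == 1%N)%:R).
have disj d : component Zb d = 0 \/ component Zc d = 0.
  rewrite !component_in_block; have [->|] := eqVneq d b; last by left.
  by right; rewrite (negPf neq_bc).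
exists (Zb + Zc), 1; split => //.
- apply: contraNneq (_ : Zb != 0) => [ZbZc0|]; last first.
    by apply: (@in_block_neq0 _ _ 0%N); rewrite // oner_eq0.
  apply/eqP/componentP => d; rewrite component0; have [//|Zc0] := disj d.
  by rewrite -[LHS]addr0 -Zc0 -componentD ZbZc0 component0.
(* With [l = L a], the diagonals [(1 + l, l)] and [(l, 1 + l)] add up to [1 + 2 * l] in both
   entries. *)
- rewrite momentD // !moment_in_block !block_moment_weight ?Kc //.
  rewrite Lb Lc Kb subn0 subnn mx22D !addr0 -mx22_scalar /block_weight.
  by rewrite weight_intr Ka1; congr mx22; ring.
- move=> d; rewrite componentD !component_in_block.
  have [->|_] := eqVneq d b; first by rewrite /block_weight Lb Kb Ka1 eqxx.
  have [->|_] := eqVneq d c; first by rewrite /block_weight Lc Kc Ka1 eqxx.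
  by rewrite addr0.
Qed.

Lemma moment_has_zero a b : generic L K ->
  block_weight a <= 0 -> 0 <= block_weight b -> exists2 Z : W, Z != 0 & moment Z = 0.
Proof.
move=> gen; have [Za [ca [Za0 ca_gt0 Ma Sa]]] := balanced_vector a gen.
have [Zb [cb [Zb0 cb_gt0 Mb Sb]]] := balanced_vector b gen.
(* A balanced vector of weight zero is already a zero of the moment. *)
rewrite le_eqVlt => /predU1P[wa0 _|wa_lt0].
  by exists Za; rewrite // Ma wa0 mulr0 raddf0.
rewrite le_eqVlt => /predU1P[wb0|wb_gt0].
  by exists Zb; rewrite // Mb -wb0 mulr0 raddf0.
have disj d : component Za d = 0 \/ component Zb d = 0.
  have [wd|/Sa] := eqVneq (block_weight d) (block_weight a); last by left.
  by right; apply: Sb; rewrite wd lt_eqF // (lt_trans wa_lt0).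
(* Crossed coefficients: each vector is scaled by the square root of the absolute value of the other
   one's moment, and the opposite signs cancel. *)
have xa_gt0 : 0 < cb * (block_weight b)%:~R by rewrite mulr_gt0 // ltr0z.
have xb_gt0 : 0 < - (ca * (block_weight a)%:~R).
  by rewrite -mulrN -mulrNz mulr_gt0 // ltr0z oppr_gt0.
exists (sqrtC (cb * (block_weight b)%:~R) *: Za
        + sqrtC (- (ca * (block_weight a)%:~R)) *: Zb).
  (* As the supports are disjoint, a vanishing sum would kill every component of [Za]. *)
  apply: contraNneq Za0 => Z0; apply/eqP/componentP => d; rewrite component0.
  have [//|Zb_d0] := disj d.
  have /(congr1 (fun Z => component Z d)) := Z0.
  rewrite componentD !componentZ Zb_d0 scaler0 addr0 component0 => /eqP.
  by rewrite scaler_eq0 sqrtC_eq0 gt_eqF // => /eqP.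
rewrite momentD => [|d]; last first.
  by rewrite !componentZ; have [->|->] := disj d; rewrite scaler0; [left|right].
rewrite !momentZ -!normrX !sqrtCK (gtr0_norm xa_gt0) (gtr0_norm xb_gt0) Ma Mb.
by rewrite !scale_scalar_mx -raddfD /= mulNr [X in X - _]mulrC subrr raddf0.
Qed.

(** * The trace obstruction *)

Lemma mxtrace_moment (Z : W) :
  \tr (moment Z) = \sum_(a < r) (block_weight a)%:~R * normsq (component Z a).
Proof. by rewrite raddf_sum; apply: eq_bigr => a _; exact: mxtrace_block_moment. Qed.

(** Weights of one strict sign make the trace a definite form in [Z]; the negative case follows by
    negating the weights. *)
Lemma mxtrace_moment_neq0 (Z : W) : Z != 0 ->
  (forall a, 0 < block_weight a) \/ (forall a, block_weight a < 0) ->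
  \tr (moment Z) != 0.
Proof.
rewrite mxtrace_moment => Z0 wP; apply: contraNneq Z0.
have weighted0 (w : 'I_r -> int) : (forall a, 0 < w a) ->
    \sum_(a < r) (w a)%:~R * normsq (component Z a) = 0 -> Z = 0.
  move=> w_gt0 /eqP; rewrite psumr_eq0 => [/allP s0|a _]; last first.
    by rewrite mulr_ge0 ?normsq_ge0 // ler0z ltW.
  apply/componentP => a; apply/eqP; rewrite component0 -normsq_eq0.
  by have := s0 a (mem_index_enum a); rewrite mulf_eq0 intr_eq0 gt_eqF.
case: wP => [w_gt0 /(weighted0 _ w_gt0)->//|w_lt0 s0].
apply/eqP; apply: (weighted0 (fun a => - block_weight a)) => [a|].
  by rewrite oppr_gt0.
by under eq_bigr do rewrite mulrNz mulNr; rewrite sumrN s0 oppr0.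
Qed.

(** The trace sees only the diagonal of [Phi], which [Psi] retains, so the obstruction already
    applies to the torus. *)
Lemma Psi_eq0_mxtrace (x : proj_space W) :
  Psi L K x = 0 -> \tr (moment (proj_repr x)) = 0.
Proof.
move=> /matrixP Psi0; have Phi0 i : Phi L K x i i = 0.
  by have := Psi0 i i; rewrite !mxE eqxx mulr1n.
have : \tr (Phi L K x) = 0 by rewrite /mxtrace big1.
rewrite /Phi Phi_vecE mxtraceZ => /eqP; rewrite mulf_eq0 => /orP[|/eqP//].
rewrite mulf_eq0 invr_eq0 normsq_eq0 (negPf (neq0Ci _)) /=.
by rewrite (negPf (proj_repr_neq0 x)).
Qed.

End Moment.

Unset Implicit Arguments.
Set Strict Implicit.

Theorem proposition2p5 (R : realType) (r : nat) (hr : (1 <= r)%N)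
    (L : 'I_r -> int) (K : 'I_r -> nat) (hgen : generic L K) :
  let cond1 := ~ (range (Psi L K)) (0 : 'M[R[i]]_2) in
  let cond2 := ~ (range (Phi L K)) (0 : 'M[R[i]]_2) in
  let cond3 := (forall a : 'I_r, 0 < (K a)%:Z + 2 * L a) \/
               (forall a : 'I_r, (K a)%:Z + 2 * L a < 0) in
  (cond1 <-> cond2) /\ (cond2 <-> cond3).
Proof.
move=> cond1 cond2 cond3.
have c12 : cond1 -> cond2.
  move=> n1 [x _ Phi0]; apply: n1; exists x => //.
  by apply/matrixP => i j; rewrite /Psi Phi0 !mxE mul0rn.
(* By contraposition: if both alternatives fail, some weight is [<= 0] and some weight is [>= 0],
   which yields a zero of [Phi]. *)
have c23 : cond2 -> cond3.
  move=> n2; have [/forallP pos|] := boolP [forall a, 0 < block_weight L K a].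
    by left.
  rewrite negb_forall => /existsP[a]; rewrite -leNgt => wa.
  have [/forallP neg|] := boolP [forall a, block_weight L K a < 0].
    by right.
  rewrite negb_forall => /existsP[b]; rewrite -leNgt => wb.
  have [Z Z0 M0] := @moment_has_zero R _ _ _ _ _ hgen wa wb.
  by case: n2; exists (proj_pt Z0); rewrite // Phi_pt Phi_vecE M0 scaler0.
have c31 : cond3 -> cond1.
  move=> c3 [x _ /Psi_eq0_mxtrace/eqP]; apply/negP.
  exact: mxtrace_moment_neq0 (proj_repr_neq0 x) c3.
by split; split; auto.
Qed.
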